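(* Consider the multi-frequency WaveHoltz (MFWH) fixed-point iteration described in the context, for $\mathcal{N}_f$ Helmholtz problems with zero boundary data, and assume $B_\omega$ is nonsingular. For each $\nu=0,1,2,\ldots$, let $\hat{\mathbf e}^{(k)}_\nu=\hat{\mathbf v}^{(k)}_\nu-\hat{\mathbf u}_\nu\in\mathbb{R}^{\mathcal{N}_f}$ be the vector of errors in the $\nu$-th eigenfunction coefficients at iteration $k$. Then: (i) The errors satisfy, for all $\nu\ge 0$ and $k\ge 0$, $$\hat{\mathbf e}^{(k+1)}_\nu = M_{\lambda_\nu}\,\hat{\mathbf e}^{(k)}_\nu,\qquad M_{\lambda_\nu}=B_\omega^{-1}C_{\lambda_\nu}.$$ (ii) The matrix $M_{\lambda_\nu}$ has (at most) one non-zero eigenvalue $\mu(\lambda_\nu)$; that is, its characteristic polynomial is $z^{\mathcal{N}_f-1}\,(z-\mu(\lambda_\nu))$. (iii) The fixed-point iteration converges (that is, for every choice of initial iterates, $\hat{\mathbf e}^{(k)}_\nu\to \mathbf 0$ as $k\to\infty$ for every $\nu$) if and only if $|\mu(\lambda_\nu)|<1$ for all eigenvalues $\lambda_\nu$. (iv) The asymptotic convergence rate of the fixed-point iteration is $$\mu_\infty=\sup_{\lambda_\nu}|\mu(\lambda_\nu)|.$$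
   Context: Let $\Omega$ be a bounded domain, $\mathcal{L}=c^2\Delta$, and let $\mathcal{B}$ be a Dirichlet, Neumann or Robin boundary operator on $\partial\Omega$. Assume that the eigenvalue problem $\mathcal{L}\phi=-\lambda^2\phi$ in $\Omega$, $\mathcal{B}\phi=0$ on $\partial\Omega$, has a complete set of linearly independent eigenfunctions $\phi_\nu$ with eigenvalues $\lambda_\nu\ge 0$, $\nu=0,1,2,\ldots$. Functions on $\Omega$ are represented by their eigenfunction expansions, with hats and subscript $\nu$ denoting the coefficient of $\phi_\nu$; expansions are manipulated coefficient by coefficient. Helmholtz problems: let $0<\omega_1<\omega_2<\cdots<\omega_{\mathcal{N}_f}$ be frequencies, none at resonance ($\omega_m\ne\lambda_\nu$ for all $m,\nu$). For $m=1,\ldots,\mathcal{N}_f$, $u^{(m)}$ solves $\mathcal{L}u^{(m)}+\omega_m^2u^{(m)}=f^{(m)}(\mathbf x)$ in $\Omega$, $\mathcal{B}u^{(m)}=0$ on $\partial\Omega$. Equivalently $\hat u^{(m)}_\nu=\hat f^{(m)}_\nu/(\omega_m^2-\lambda_\nu^2)$. Write $\hat{\mathbf u}_\nu=[\hat u^{(1)}_\nu,\ldots,\hat u^{(\mathcal{N}_f)}_\nu]^T$. Times and filters: $T_m=2\pi/\omega_m$; $N_p$ is a given positive integer; $T_f=N_pT_1$; $N_{p,m}=\lfloor T_f/T_m\rfloor$; $T_{f,m}=N_{p,m}T_m$. For real parameters $\mathbf p_m=(a_m,c_m,s_m)$ let $\mathcal{K}(\tau;\mathbf p_m)=a_m+c_m\cos\tau+s_m\sin\tau$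 and define the filter functions $$\beta_m(\lambda)=\frac{2}{T_{f,m}}\int_0^{T_{f,m}}\mathcal{K}(\omega_mt;\mathbf p_m)\cos(\lambda t)\,dt,\qquad m=1,\ldots,\mathcal{N}_f.$$ Let $B_\omega$ be the $\mathcal{N}_f\times\mathcal{N}_f$ matrix with $(i,j)$ entry $\beta_i(\omega_j)$, and let $C_\lambda$ be the $\mathcal{N}_f\times\mathcal{N}_f$ matrix with $(i,j)$ entry $\beta_i(\lambda)$ for every $j$ (all columns equal, so rank at most one). MFWH fixed-point iteration: given iterates $v^{(m,k)}(\mathbf x)$, $m=1,\ldots,\mathcal{N}_f$ (approximations of $u^{(m)}$), let $\mathrm{w}(\mathbf x,t)$ solve the wave equation $$\partial_t^2\mathrm{w}=\mathcal{L}\mathrm{w}-\sum_{m=1}^{\mathcal{N}_f}f^{(m)}(\mathbf x)\cos(\omega_mt)\ \text{ in }\Omega,\quad t\in[0,T_f],\qquad \mathcal{B}\mathrm{w}=0\ \text{ on }\partial\Omega,$$ with initial conditions $\mathrm{w}(\mathbf x,0)=\sum_{m=1}^{\mathcal{N}_f}v^{(m,k)}(\mathbf x)$ and $\partial_t\mathrm{w}(\mathbf x,0)=0$. The new iterates $v^{(m,k+1)}$ are defined by the linear system $$\sum_{j=1}^{\mathcal{N}_f}\beta_m(\omega_j)\,v^{(j,k+1)}(\mathbf x)=\frac{2}{T_{f,m}}\int_0^{T_{f,m}}\mathcal{K}(\omega_mt;\mathbf p_m)\,\mathrm{w}(\mathbf x,t)\,dt,\qquad m=1,\ldots,\mathcal{N}_f.$$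 Write $\hat{\mathbf v}^{(k)}_\nu=[\hat v^{(1,k)}_\nu,\ldots,\hat v^{(\mathcal{N}_f,k)}_\nu]^T$. The asymptotic convergence rate of the fixed-point iteration means the supremum over $\nu$ of the spectral radii of the matrices governing the error iteration in each eigenfunction component. *)

(* Defs.v *)
(* MathComp / MathComp-Analysis development. *)
From HB Require Import structures.
From mathcomp Require Import all_boot all_order all_algebra.
From mathcomp Require Import all_classical all_reals all_analysis.
From mathcomp Require Import complex.

Set Implicit Arguments.
Unset Strict Implicit.
Unset Printing Implicit Defensive.

Import Order.TTheory GRing.Theory Num.Theory.
Import numFieldNormedType.Exports.

Local Open Scope classical_set_scope.
Local Open Scope ring_scope.

Section SpatialProblem.
Context {R : realType}.

Definition coord_vec (d : nat) (i : 'I_d.+1) : 'rV[R]_d.+1 := delta_mx 0 i.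

Definition dotv (d : nat) (x y : 'rV[R]_d.+1) : R := \sum_i x 0 i * y 0 i.

Definition partial_d (d : nat) (i : 'I_d.+1) (g : 'rV[R]_d.+1 -> R)
  : 'rV[R]_d.+1 -> R := fun x => 'D_(coord_vec i) g x.

Definition laplacian (d : nat) (g : 'rV[R]_d.+1 -> R) (x : 'rV[R]_d.+1) : R :=
  \sum_i partial_d i (partial_d i g) x.

Definition C2_on (d : nat) (Omega : set 'rV[R]_d.+1) (g : 'rV[R]_d.+1 -> R) :=
  forall x, Omega x ->
    {for x, continuous g} /\
    forall i, [/\ derivable g x (coord_vec i), {for x, continuous (partial_d i g)}
      & forall j, derivable (partial_d i g) x (coord_vec j) /\
                  {for x, continuous (partial_d j (partial_d i g))}].

Definition boundary (d : nat) (Omega : set 'rV[R]_d.+1) : set 'rV[R]_d.+1 :=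
  closure Omega `\` interior Omega.

(* Near x the set Omega agrees with the half-space {y | (y - x).nv < 0} up to
   o(|y - x|); at a C^1 boundary point this is the usual outward unit normal,
   and at a corner there is none. *)
Definition outward_unit_normal (d : nat) (Omega : set 'rV[R]_d.+1)
    (x nv : 'rV[R]_d.+1) : Prop :=
  dotv nv nv = 1 /\
  forall e : R, 0 < e -> \forall y \near x,
    (Omega y -> dotv (y - x) nv <= e * `|y - x|) /\
    (dotv (y - x) nv < - (e * `|y - x|) -> Omega y).

Inductive boundary_operator (d : nat) : Type :=
| Dirichlet
| Neumann
| Robin of ('rV[R]_d.+1 -> R) & ('rV[R]_d.+1 -> R).

Definition interior_quotient (d : nat) (g : 'rV[R]_d.+1 -> R)
    (x nv : 'rV[R]_d.+1) (h : R) : R :=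
  h^-1 * (g x - g (x - h *: nv)).

(* B g = 0 on the boundary of Omega.  The outward normal derivative is the
   one-sided limit of interior_quotient, so that only values of g on the closure
   of Omega matter; conditions involving it are imposed at the boundary points
   that have an outward unit normal. *)
Definition satisfies_bc (d : nat) (Omega : set 'rV[R]_d.+1)
    (B : boundary_operator d) (g : 'rV[R]_d.+1 -> R) : Prop :=
  match B with
  | Dirichlet => forall x, boundary Omega x -> g x = 0
  | Neumann => forall x nv, boundary Omega x -> outward_unit_normal Omega x nv ->
      interior_quotient g x nv h @[h --> 0^'+] --> (0 : R)
  | Robin a b => forall x nv, boundary Omega x -> outward_unit_normal Omega x nv ->
      a x * g x + b x * interior_quotient g x nv h @[h --> 0^'+] --> (0 : R)
  end.

Definition wf_boundary_operator (d : nat) (Omega : set 'rV[R]_d.+1)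
    (B : boundary_operator d) : Prop :=
  if B is Robin a b
  then forall x, boundary Omega x -> a x != 0 \/ b x != 0 else True.

(* Iterated one-dimensional Lebesgue integrals; by Tonelli this is the
   d-dimensional Lebesgue integral for nonnegative Borel integrands. *)
Fixpoint iter_integral (d : nat) : ('rV[R]_d -> \bar R) -> \bar R :=
  match d return ('rV[R]_d -> \bar R) -> \bar R with
  | 0 => fun g => g 0
  | d'.+1 => fun g =>
      (\int[lebesgue_measure]_(t in [set: R])
         iter_integral (fun y : 'rV[R]_d' =>
           g (row_mx (const_mx t : 'rV[R]_1) y : 'rV[R]_(1 + d'))))%E
  end.

Definition sq_integral (d : nat) (Omega : set 'rV[R]_d.+1)
    (g : 'rV[R]_d.+1 -> R) : \bar R :=
  iter_integral (fun x => ((if x \in Omega then g x ^+ 2 else 0)%:E)).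

Definition borel_function (d : nat) (g : 'rV[R]_d.+1 -> R) : Prop :=
  forall A : set R, open A -> <<s [set U : set 'rV[R]_d.+1 | open U] >> (g @^-1` A).

(* The finite linear combinations of the phi nu are dense in L^2(Omega). *)
Definition complete_family (d : nat) (Omega : set 'rV[R]_d.+1)
    (phi : nat -> 'rV[R]_d.+1 -> R) : Prop :=
  forall g : 'rV[R]_d.+1 -> R, borel_function g ->
    (sq_integral Omega g < +oo)%E ->
    forall e : R, 0 < e -> exists (N : nat) (a : nat -> R),
      (sq_integral Omega (fun x => (g x - \sum_(nu < N) a nu * phi nu x)%R) < e%:E)%E.

Definition lin_independent (d : nat) (Omega : set 'rV[R]_d.+1)
    (phi : nat -> 'rV[R]_d.+1 -> R) : Prop :=
  forall (N : nat) (a : nat -> R),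
    (forall x, Omega x -> \sum_(nu < N) a nu * phi nu x = 0) ->
    forall nu, (nu < N)%N -> a nu = 0.

End SpatialProblem.

Record spatial_problem (R : realType) (d : nat) := SpatialProblem {
  domain : set 'rV[R]_d.+1;
  wave_speed : R;
  bop : @boundary_operator R d;
  eigenfun : nat -> 'rV[R]_d.+1 -> R;
  eigenval : nat -> R }.

Section WaveHoltz.
Context {R : realType} {d n : nat}.
Variable P : spatial_problem R d.

(* The operator c^2 Delta. *)
Definition Lop (g : 'rV[R]_d.+1 -> R) (x : 'rV[R]_d.+1) : R :=
  wave_speed P ^+ 2 * laplacian g x.

Definition is_spatial_problem : Prop :=
  [/\ [/\ open (domain P), connected (domain P), domain P !=set0
        & bounded_set (domain P)],
      0 < wave_speed P, wf_boundary_operator (domain P) (bop P),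
      forall nu,
        [/\ 0 <= eigenval P nu, C2_on (domain P) (eigenfun P nu),
            {within closure (domain P), continuous (eigenfun P nu)},
            forall x, domain P x ->
              Lop (eigenfun P nu) x = - eigenval P nu ^+ 2 * eigenfun P nu x
          & satisfies_bc (domain P) (bop P) (eigenfun P nu)]
    & lin_independent (domain P) (eigenfun P) /\
      complete_family (domain P) (eigenfun P)].

(* A function on the domain is represented by the coefficients of its
   eigenfunction expansion; equations between expansions are imposed term by
   term, the differential operators being applied to each term. *)
Definition expansion := nat -> R.

Definition term (g : expansion) (nu : nat) (x : 'rV[R]_d.+1) : R :=
  g nu * eigenfun P nu x.

Definition solves_helmholtz (w : R) (f u : expansion) : Prop :=
  forall nu,
    (forall x, domain P x ->
       Lop (term u nu) x + w ^+ 2 * term u nu x = term f nu x) /\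
    satisfies_bc (domain P) (bop P) (term u nu).

Variables (omega : 'I_n.+1 -> R) (Np : nat).

Definition period (m : 'I_n.+1) : R := 2 * pi / omega m.

Definition Tf : R := Np%:R * period ord0.

Definition Npm (m : 'I_n.+1) : int := Num.floor (Tf / period m).

Definition Tfm (m : 'I_n.+1) : R := (Npm m)%:~R * period m.

(* Filter parameters (a_m, c_m, s_m). *)
Variables (a c s : 'I_n.+1 -> R).

Definition filter_kernel (m : 'I_n.+1) (tau : R) : R :=
  a m + c m * cos tau + s m * sin tau.

(* (2 / T_{f,m}) int_0^{T_{f,m}} K(omega_m t; p_m) g(t) dt *)
Definition time_filter (m : 'I_n.+1) (g : R -> R) : R :=
  2 / Tfm m * \int[lebesgue_measure]_(t in `[0, Tfm m])
                (filter_kernel m (omega m * t) * g t).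

Definition beta (m : 'I_n.+1) (lam : R) : R :=
  time_filter m (fun t => cos (lam * t)).

Definition B_omega : 'M[R]_n.+1 := \matrix_(i, j) beta i (omega j).

Definition C_mat (lam : R) : 'M[R]_n.+1 := \matrix_(i, j) beta i lam.

Definition M_mat (lam : R) : 'M[R]_n.+1 := invmx B_omega *m C_mat lam.

Variable f : 'I_n.+1 -> expansion.

(* w solves the wave equation on [0, Tf] with initial value w0 and zero initial
   velocity; wt is the velocity.  Each coefficient is C^1 on [0, Tf] and
   satisfies the equation on ]0, Tf[ (hence at the end points, one-sidedly). *)
Definition solves_wave (w0 : expansion) (w wt : R -> expansion) : Prop :=
  forall nu,
  [/\ {within `[0, Tf], continuous (fun t => w t nu)} /\
      {within `[0, Tf], continuous (fun t => wt t nu)},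
      w 0 nu = w0 nu /\ wt 0 nu = 0,
      forall t, t \in `]0, Tf[ -> is_derive t 1 (fun t' => w t' nu) (wt t nu),
      forall t x, t \in `]0, Tf[ -> domain P x ->
        is_derive t 1 (fun t' => term (wt t') nu x)
          (Lop (term (w t) nu) x
           - \sum_m term (f m) nu x * cos (omega m * t))
    & forall t, t \in `[0, Tf] ->
        satisfies_bc (domain P) (bop P) (term (w t) nu)].

Definition mfwh_step (v v' : 'I_n.+1 -> expansion) : Prop :=
  exists w wt : R -> expansion,
    solves_wave (fun nu => \sum_m v m nu) w wt /\
    forall m nu,
      \sum_j beta m (omega j) * v' j nu = time_filter m (fun t => w t nu).

Definition mfwh_iteration (v : nat -> 'I_n.+1 -> expansion) : Prop :=
  forall k, mfwh_step (v k) (v k.+1).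

Definition error (u : 'I_n.+1 -> expansion) (v : nat -> 'I_n.+1 -> expansion)
    (k nu : nat) : 'cV[R]_n.+1 :=
  \col_m (v k m nu - u m nu).

Definition mfwh_converges (u : 'I_n.+1 -> expansion) : Prop :=
  forall v, mfwh_iteration v ->
    forall nu, (fun k => error u v k nu) @ \oo --> (0 : 'cV[R]_n.+1).

Definition governs_error (u : 'I_n.+1 -> expansion) (nu : nat)
    (A : 'M[R]_n.+1) : Prop :=
  forall v, mfwh_iteration v ->
    forall k, error u v k.+1 nu = A *m error u v k nu.

End WaveHoltz.

Section Rate.
Context {R : realType}.

(* Largest modulus of a complex eigenvalue of a real matrix. *)
Definition spectral_radius (n : nat) (A : 'M[R]_n.+1) : R :=
  sup [set ComplexField.Normc.normc z | z in
    [set z : R[i] | eigenvalue (map_mx (real_complex R) A : 'M[R[i]]_n.+1) z]].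

Definition asymptotic_rate (d n : nat) (P : spatial_problem R d)
    (omega : 'I_n.+1 -> R) (Np : nat) (a c s : 'I_n.+1 -> R)
    (f u : 'I_n.+1 -> expansion) : \bar R :=
  ereal_sup [set r | exists (nu : nat) (A : 'M[R]_n.+1),
    governs_error P omega Np a c s f u nu A /\ r = (spectral_radius A)%:E].

End Rate.

(* Main.v *)
Require Import Defs.
From HB Require Import structures.
From mathcomp Require Import all_boot all_order all_algebra.
From mathcomp Require Import all_classical all_reals all_analysis.
From mathcomp Require Import ring.
From mathcomp Require Import complex.

(* Fix an eigenfunction phi_nu and write lambda = lambda_nu.  Since phi_nu is
   not identically zero on Omega, the PDEs become scalar equations for the
   coefficients: f_m = (omega_m^2 - lambda^2) u_m, and the wave coefficient w
   minus sum_m u_m cos(omega_m t) solves y'' = - lambda^2 y with y'(0) = 0.  By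
   conservation of the energy y'^2 + lambda^2 y^2,
     w(t) = sum_m u_m cos(omega_m t) + (sum_m e_m) cos(lambda t)  on [0, T_f],
   where e is the current error.  Filtering yields
   B_omega e' = beta(lambda) (sum_m e_m) = C_lambda e.  Finally
   M = B_omega^-1 C_lambda is the product of the column
   B_omega^-1 beta(lambda) and the row of ones, so that its nonzero eigenvalue
   mu is their product in the other order and M^(k+1) = mu^k M. *)

Set Implicit Arguments.
Unset Strict Implicit.
Unset Printing Implicit Defensive.

Import Order.TTheory GRing.Theory Num.Theory.
Import numFieldNormedType.Exports.

Local Open Scope classical_set_scope.
Local Open Scope ring_scope.

(** * Linear algebra of rank-one matrices *)

Lemma det_scalar_sub_rank1 (D : idomainType) (n : nat) (t : D)
    (x : 'cV[D]_n.+1) (y : 'rV[D]_n.+1) :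
  t != 0 -> \det (t%:M - x *m y) = t ^+ n * (t - (y *m x) 0 0).
Proof.
move=> t0; apply: (mulIf t0).
(* The determinant of [W] is computed by eliminating either diagonal block. The second elimination
   costs a factor [t], which is why both sides were first multiplied by [t]. *)
pose W := block_mx (1%:M : 'M[D]_1) y x t%:M.
have detW : \det W = \det (t%:M - x *m y).
  have -> : W = block_mx (1%:M : 'M[D]_1) 0 x 1%:M
      *m block_mx 1%:M y 0 (t%:M - x *m y).
    rewrite mulmx_block !mul1mx !mulmx1 !mul0mx ?mulmx0 !addr0.
    by rewrite addrCA subrr addr0.
  by rewrite det_mulmx det_lblock det_ublock !det1 !mul1r.
have WE : W *m block_mx (t%:M : 'M[D]_1) 0 (- x) 1%:M
    = block_mx (t%:M - y *m x) y 0 t%:M.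
  rewrite mulmx_block !mul1mx !mulmx1 !mulmx0 !add0r mulmxN.
  by rewrite mulmxN mul_mx_scalar mul_scalar_mx subrr.
have /(congr1 determinant) := WE.
rewrite det_mulmx det_lblock det_ublock detW !det_scalar expr1 expr1n.
rewrite mulr1 det_mx11 !mxE eqxx mulr1n => ->.
by rewrite exprS; ring.
Qed.

(** The previous identity over the polynomial ring, with ['X] in the role of the nonzero scalar. *)
Lemma char_poly_rank1 (F : fieldType) (n : nat)
    (x : 'cV[F]_n.+1) (y : 'rV[F]_n.+1) :
  char_poly (x *m y) = 'X^n * ('X - ((y *m x) 0 0)%:P).
Proof.
rewrite /char_poly /char_poly_mx map_mxM det_scalar_sub_rank1 ?polyX_eq0//.
by rewrite -map_mxM mxE.
Qed.

(** Regrouping leaves scalar factors [y *m x] between the outer [x] and [y]. The exponent starts at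
    one because the zeroth power is the identity, in general not a multiple of [x *m y]. *)
Lemma expmx_rank1 (F : comNzRingType) (n : nat)
    (x : 'cV[F]_n.+1) (y : 'rV[F]_n.+1) (k : nat) :
  (x *m y) ^+ k.+1 = (y *m x) 0 0 ^+ k *: (x *m y).
Proof.
elim: k => [|k IH]; first by rewrite expr0 scale1r.
rewrite exprS IH -mulmxE -scalemxAr mulmxA -(mulmxA x).
rewrite [y *m x]mx11_scalar mxE eqxx mulr1n mul_mx_scalar -scalemxAl scalerA.
by rewrite -exprSr.
Qed.

(** Complex eigenvalues are roots of the mapped characteristic polynomial, so each is 0 or [m], and
    [m] itself always occurs; the supremum is therefore attained at [m]. *)
Lemma spectral_radius_rank1 (R : realType) (n : nat) (A : 'M[R]_n.+1) (m : R) :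
  char_poly A = 'X^n * ('X - m%:P) -> spectral_radius A = `|m|.
Proof.
move=> chA.
have eigE (z : R[i]) :
    eigenvalue (map_mx (real_complex R) A : 'M[R[i]]_n.+1) z ->
    z = 0 \/ z = real_complex R m.
  rewrite eigenvalue_root_char -map_char_poly chA rmorphM rmorphB/= rmorphXn/=.
  rewrite map_polyX map_polyC rootM root_XsubC => /orP[|/eqP ->]; last by right.
  by rewrite rootE hornerXn expf_eq0 => /andP[_ /eqP]; left.
have eigm : eigenvalue (map_mx (real_complex R) A : 'M[R[i]]_n.+1)
              (real_complex R m).
  rewrite eigenvalue_root_char -map_char_poly chA rmorphM rmorphB/=.
  by rewrite map_polyX map_polyC rootM root_XsubC eqxx orbT.
have normm : ComplexField.Normc.normc (real_complex R m) = `|m|.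
  by rewrite /= expr0n addr0 sqrtr_sqr.
have ubm : ubound [set ComplexField.Normc.normc z | z in
    [set z | eigenvalue (map_mx (real_complex R) A : 'M[R[i]]_n.+1) z]] `|m|.
  move=> _ /= [z /eigE[->|->] <-]; last by rewrite normm.
  by rewrite /= !expr0n/= addr0 sqrtr0.
have inm : [set ComplexField.Normc.normc z | z in
    [set z | eigenvalue (map_mx (real_complex R) A : 'M[R[i]]_n.+1) z]] `|m|.
  by exists (real_complex R m).
apply/le_anti/andP.
by split; [apply: ge_sup|apply: ub_le_sup] => //; exists `|m|.
Qed.

(** * Scaling and nonvanishing of functions on the domain *)

Section space.
Context {R : realType} {d : nat}.
Implicit Types (Omega : set 'rV[R]_d.+1) (g : 'rV[R]_d.+1 -> R).

(** The outer derivative sees the inner one on a whole neighbourhood of [x]; openness of [Omega]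
    makes the first-order scaling identity hold there. *)
Lemma laplacianZ Omega g (k : R) (x : 'rV[R]_d.+1) :
  open Omega -> C2_on Omega g -> Omega x ->
  laplacian (fun y => k * g y) x = k * laplacian g x.
Proof.
move=> oO gC2 Ox; rewrite /laplacian mulr_sumr; apply: eq_bigr => i _.
have [_ /(_ i)[_ _ /(_ i)[dd _]]] := gC2 _ Ox.
rewrite {1}/partial_d (@near_eq_derive _ _ _ _ (k \*: partial_d i g)).
  by rewrite deriveZ.
have : \near x, Omega x by exact: open_nbhs_nbhs.
apply: filterS => y Oy; rewrite /partial_d/=.
by have [_ /(_ i)[dg _ _]] := gC2 _ Oy; exact: (deriveZ k dg).
Qed.

Lemma satisfies_bcZ Omega (B : boundary_operator d) g (k : R) :
  satisfies_bc Omega B g -> satisfies_bc Omega B (fun x => k * g x).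
Proof.
have iqZ x nv h : interior_quotient (fun x => k * g x) x nv h
    = k * interior_quotient g x nv h by rewrite /interior_quotient; ring.
have limZ (q : R -> R) :
    q h @[h --> 0^'+] --> (0 : R) -> k * q h @[h --> 0^'+] --> (0 : R).
  move=> q0; have : k * q h @[h --> 0^'+] --> k * 0.
    by apply: cvgM; [exact: cvg_cst|exact: q0].
  by rewrite mulr0.
case: B => [|| b c] /= bc x; first by move=> /bc ->; rewrite mulr0.
- move=> nv Ox nx; under eq_fun do rewrite iqZ.
  by apply: limZ; exact: bc.
- move=> nv Ox nx.
  under eq_fun do rewrite iqZ mulrCA (mulrCA (c x)) -mulrDr.
  by apply: limZ; exact: bc.
Qed.

Lemma lin_independent_neq0 Omega (phi : nat -> 'rV[R]_d.+1 -> R) (nu : nat) :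
  lin_independent Omega phi -> exists2 x, Omega x & phi nu x != 0.
Proof.
move=> indep; apply: contrapT => phi0.
have /(_ _ nu (ltnSn nu)) := indep nu.+1 (fun i => (i == nu)%:R).
rewrite eqxx => one0; suff /eqP : (1 : R) = 0 by rewrite oner_eq0.
apply: one0 => x Ox; rewrite big_ord_recr/= eqxx mul1r big1 ?add0r.
  by apply: contrapT => /eqP phix; apply: phi0; exists x.
by move=> i _; rewrite ltn_eqF// mul0r.
Qed.

End space.

(** * Uniqueness for the harmonic oscillator *)

Section oscillator.
Context {R : realType}.

Lemma is_derive_cosM (w t : R) :
  is_derive t 1 (fun t => cos (w * t)) (- w * sin (w * t)).
Proof. by apply: is_derive_eq; rewrite /GRing.scale/=; ring. Qed.

Lemma is_derive_sinM (w t : R) :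
  is_derive t 1 (fun t => sin (w * t)) (w * cos (w * t)).
Proof. by apply: is_derive_eq; rewrite /GRing.scale/=; ring. Qed.

Lemma is_derive_sumf (k : nat) (h : 'I_k -> R -> R) (dh : 'I_k -> R) (t : R) :
  (forall i, is_derive t 1 (h i) (dh i)) ->
  is_derive t 1 (fun t => \sum_i h i t) (\sum_i dh i).
Proof. by move=> hdh; rewrite -fct_sumE; exact: is_derive_sum. Qed.

Lemma is_derive_continuous (g g' : R -> R) :
  (forall t : R, is_derive t 1 g (g' t)) -> continuous g.
Proof.
move=> dg t; apply: (@differentiable_continuous R R R).
by apply/derivable1_diffP; have ? := dg t; exact: ex_derive.
Qed.

Lemma continuous_cosM (w : R) : continuous (fun t => cos (w * t)).
Proof. exact: is_derive_continuous (is_derive_cosM w). Qed.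

Lemma constant_segment (T : R) (g : R -> R) :
  0 < T -> {within `[0, T], continuous g} ->
  (forall t, t \in `]0, T[ -> is_derive t 1 g 0) ->
  forall t, t \in `[0, T] -> g t = g 0.
Proof.
move=> T0 cg dg t; rewrite in_itv/= => /andP[t0 tT].
have [//|//||c _] := @MVT_segment R g (cst 0) 0 t.
- move=> x; rewrite in_itv/= => /andP[x0 xt]; apply: dg.
  by rewrite in_itv/= x0 (lt_le_trans xt).
- apply: continuous_subspaceW cg => x/=.
  by rewrite !in_itv/= => /andP[-> /le_trans]; exact.
- by rewrite /cst/= mul0r => /eqP; rewrite subr_eq0 => /eqP.
Qed.

Lemma oscillator_eq0 (T lam : R) (y y' : R -> R) :
  0 < T ->
  {within `[0, T], continuous y} -> {within `[0, T], continuous y'} ->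
  y 0 = 0 -> y' 0 = 0 ->
  (forall t, t \in `]0, T[ -> is_derive t 1 y (y' t)) ->
  (forall t, t \in `]0, T[ -> is_derive t 1 y' (- lam ^+ 2 * y t)) ->
  forall t, t \in `[0, T] -> y t = 0.
Proof.
move=> T0 cy cy' y0 y'0 dy dy'.
pose E := fun t => y' t ^+ 2 + lam ^+ 2 * y t ^+ 2.
have E0 t : t \in `[0, T] -> E t = 0.
  move=> tT; suff -> : E t = E 0 by rewrite /E y0 y'0 expr0n mulr0 addr0.
  apply: constant_segment tT => //.
  - move=> x; apply: cvgD; first by apply: cvgM; [exact: cy'|exact: cy'].
    apply: cvgM; first exact: cvg_cst.
    by apply: cvgM; [exact: cy|exact: cy].
  - move=> s sT; have ? := dy _ sT; have ? := dy' _ sT.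
    by apply: is_derive_eq; rewrite /GRing.scale/=; ring.
(* Only [y'] is read off from the zero energy: for [lam = 0] the energy does not control [y]. A
   vanishing derivative then keeps [y] at its initial value. *)
have y't0 t : t \in `[0, T] -> y' t = 0.
  have ge0 : 0 <= lam ^+ 2 * y t ^+ 2 by rewrite -exprMn sqr_ge0.
  move=> /E0/eqP; rewrite /E paddr_eq0 ?sqr_ge0//.
  by rewrite sqrf_eq0 => /andP[/eqP].
move=> t tT; rewrite -y0; apply: constant_segment tT => // s sT.
have <- : y' s = 0 by apply: y't0; exact: subset_itv_oo_cc sT.
exact: dy.
Qed.

End oscillator.

(** * Linearity of the time filter *)

Section filter.
Context {R : realType} {n : nat}.
Variables (omega : 'I_n.+1 -> R) (Np : nat) (a c s : 'I_n.+1 -> R).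

Let D m : set R := `[0, Tfm omega Np m]%classic.

Lemma filter_integrable m (g : R -> R) :
  {within D m, continuous g} ->
  lebesgue_measure.-integrable (D m)
    (EFin \o (fun t => filter_kernel a c s m (omega m * t) * g t)).
Proof.
move=> cg; apply: continuous_compact_integrable; first exact: segment_compact.
move=> x; apply: cvgM; last exact: cg.
suff K : continuous (fun t => filter_kernel a c s m (omega m * t)).
  exact: (continuous_subspaceT K).
move=> t; apply: (@differentiable_continuous R R R); apply/derivable1_diffP.
rewrite /filter_kernel; have ? := is_derive_cosM (omega m) t.
have ? := is_derive_sinM (omega m) t.
by apply: ex_derive.
Qed.

Lemma time_filterD m (g h : R -> R) :
  {within D m, continuous g} -> {within D m, continuous h} ->
  time_filter omega Np a c s m (fun t => g t + h t)
  = time_filter omega Np a c s m g + time_filter omega Np a c s m h.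
Proof.
move=> cg ch; rewrite /time_filter -mulrDr.
rewrite -RintegralD //; try exact: filter_integrable.
by congr (_ * _); apply: eq_Rintegral => t _; rewrite mulrDr.
Qed.

Lemma time_filterZ m (k : R) (g : R -> R) :
  {within D m, continuous g} ->
  time_filter omega Np a c s m (fun t => k * g t)
  = k * time_filter omega Np a c s m g.
Proof.
move=> cg; rewrite /time_filter mulrCA; congr (_ * _).
rewrite -RintegralZl //; try exact: filter_integrable.
by apply: eq_Rintegral => t _; rewrite mulrCA.
Qed.

Lemma eq_time_filter m (g h : R -> R) :
  {in D m, g =1 h} ->
  time_filter omega Np a c s m g = time_filter omega Np a c s m h.
Proof.
by move=> gh; congr (_ * _); apply: eq_Rintegral => t /gh ->.
Qed.

Lemma time_filter_cos_sum (I : Type) (r : seq I) (k w : I -> R) m :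
  time_filter omega Np a c s m (fun t => \sum_(i <- r) k i * cos (w i * t))
  = \sum_(i <- r) k i * beta omega Np a c s m (w i).
Proof.
have cZ (z y : R) : continuous (fun t : R => z * cos (y * t)).
  by move=> t; apply: cvgM; [exact: cvg_cst|exact: continuous_cosM].
elim: r => [|i r IH].
  rewrite big_nil.
  (* The empty sum is read as [0 * cos (0 * t)], so that homogeneity evaluates its filter. *)
  transitivity (0 * beta omega Np a c s m 0); last exact: mul0r.
  rewrite -time_filterZ; last first.
    by apply: continuous_subspaceT; exact: continuous_cosM.
  by apply: eq_time_filter => t _; rewrite big_nil mul0r.
rewrite big_cons -IH -time_filterZ; last first.
  by apply: continuous_subspaceT; exact: continuous_cosM.
rewrite -time_filterD.
- by apply: eq_time_filter => t _; rewrite big_cons.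
- by apply: continuous_subspaceT; exact: cZ.
- apply: continuous_subspaceT; apply: continuous_big => [|j _]; last exact: cZ.
  exact: add_continuous.
Qed.

End filter.

(** * Explicit solution of the wave equation, mode by mode *)

Section wave.
Context {R : realType} {d n : nat}.
Variable P : spatial_problem R d.
Hypothesis hP : is_spatial_problem P.
Variables (omega : 'I_n.+1 -> R) (Np : nat) (a c s : 'I_n.+1 -> R).
Hypothesis omega_gt0 : forall m, 0 < omega m.
Hypothesis Np_gt0 : (0 < Np)%N.
Variables f u : 'I_n.+1 -> @expansion R.
Hypothesis hu : forall m, solves_helmholtz P (omega m) (f m) (u m).

Local Notation lam := (eigenval P).
Implicit Types (g : @expansion R) (t : R) (nu : nat).

Lemma Lop_term (g : expansion) nu x : domain P x ->
  Lop P (term P g nu) x = - lam nu ^+ 2 * term P g nu x.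
Proof.
have [[oO _ _ _] _ _ /(_ nu)[_ gC2 _ eig _] _] := hP => Ox.
by rewrite /Lop /term (laplacianZ _ oO gC2 Ox) mulrCA [X in _ * X]eig// mulrCA.
Qed.

Lemma helmholtz_coef m nu : f m nu = (omega m ^+ 2 - lam nu ^+ 2) * u m nu.
Proof.
have [_ _ _ _ [indep _]] := hP.
have [x Ox phix] := lin_independent_neq0 nu indep.
have [/(_ x Ox) + _] := hu m nu.
rewrite Lop_term// /term => E; apply: (mulIf phix); rewrite -E; ring.
Qed.

Lemma Tf_gt0 : 0 < Tf omega Np.
Proof. by rewrite /Tf /period !mulr_gt0 ?ltr0n ?pi_gt0 ?invr_gt0. Qed.

(** Rounding down keeps each filter window inside [[0, Tf]], where the wave equation determines
    [w]. *)
Lemma Tfm_le_Tf m : Tfm omega Np m <= Tf omega Np.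
Proof.
have T0 : 0 < period omega m by rewrite /period !mulr_gt0 ?pi_gt0 ?invr_gt0.
by rewrite /Tfm /Npm -ler_pdivlMr// floor_le.
Qed.

(** Forced response with the Helmholtz amplitudes, plus a free oscillation carrying the mismatch
    between the initial value and the sum of these amplitudes. *)
Definition wave_mode (g : expansion) (t : R) (nu : nat) : R :=
  \sum_m u m nu * cos (omega m * t)
  + (g nu - \sum_m u m nu) * cos (lam nu * t).

Definition wave_mode' (g : expansion) (t : R) (nu : nat) : R :=
  \sum_m u m nu * (- omega m * sin (omega m * t))
  + (g nu - \sum_m u m nu) * (- lam nu * sin (lam nu * t)).

Lemma is_derive_wave_mode g t nu :
  is_derive t 1 (fun t => wave_mode g t nu) (wave_mode' g t nu).
Proof.
rewrite /wave_mode; have ? := is_derive_cosM (lam nu) t.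
apply: is_deriveD.
apply: is_derive_sumf => m; have ? := is_derive_cosM (omega m) t.
exact: is_deriveZ.
Qed.

(** By [helmholtz_coef], [- omega m ^+ 2 * u m nu] equals [- lam nu ^+ 2 * u m nu - f m nu], so the
    forced part produces exactly the forcing. *)
Lemma is_derive_wave_mode' g t nu :
  is_derive t 1 (fun t => wave_mode' g t nu)
    (- lam nu ^+ 2 * wave_mode g t nu - \sum_m f m nu * cos (omega m * t)).
Proof.
have dsin k w : is_derive t 1 (fun t => k * (- w * sin (w * t)))
    (k * - w ^+ 2 * cos (w * t)).
  have ? := is_derive_sinM w t.
  by apply: is_derive_eq; rewrite /GRing.scale/=; ring.
apply: (@is_derive_eq _ _ _ _ _ _ _
  (\sum_m u m nu * - omega m ^+ 2 * cos (omega m * t)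
   + (g nu - \sum_m u m nu) * - lam nu ^+ 2 * cos (lam nu * t))).
  by apply: is_deriveD => //; exact: is_derive_sumf.
rewrite /wave_mode mulrDr addrAC mulr_sumr -sumrB; congr (_ + _); last by ring.
by apply: eq_bigr => m _; rewrite helmholtz_coef; ring.
Qed.

Lemma continuous_wave_mode g nu : continuous (fun t => wave_mode g t nu).
Proof. by apply: is_derive_continuous => t; exact: is_derive_wave_mode. Qed.

Lemma continuous_wave_mode' g nu : continuous (fun t => wave_mode' g t nu).
Proof. by apply: is_derive_continuous => t; exact: is_derive_wave_mode'. Qed.

Lemma wave_mode0 g nu : wave_mode g 0 nu = g nu /\ wave_mode' g 0 nu = 0.
Proof.
split.
  rewrite /wave_mode mulr0 cos0 mulr1 (eq_bigr (fun m => u m nu)) ?subrKC//.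
  by move=> m _; rewrite mulr0 cos0 mulr1.
rewrite /wave_mode' !mulr0 sin0 !mulr0 addr0 big1// => m _.
by rewrite mulr0 sin0 !mulr0.
Qed.

(** Provides the witness for the existentially quantified wave in [mfwh_step]. *)
Lemma wave_mode_solves g :
  solves_wave P omega Np f g (wave_mode g) (wave_mode' g).
Proof.
move=> nu; split.
- split; apply: continuous_subspaceT;
    [exact: continuous_wave_mode|exact: continuous_wave_mode'].
- exact: wave_mode0.
- by move=> t _; exact: is_derive_wave_mode.
- move=> t x _ Ox; have ? := is_derive_wave_mode' g t nu.
  rewrite Lop_term// /term; apply: is_derive_eq.
  rewrite /GRing.scale/= mulr0 add0r mulrBr mulr_sumr.
  congr (_ - _); first by ring.
  by apply: eq_bigr => m _; ring.
- move=> t _; have [_ _ _ /(_ nu)[_ _ _ _ bc] _] := hP.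
  exact: satisfies_bcZ.
Qed.

Lemma solves_wave_unique g w wt : solves_wave P omega Np f g w wt ->
  forall t nu, t \in `[0, Tf omega Np] -> w t nu = wave_mode g t nu.
Proof.
move=> sw t nu tT; have [[cw cwt] [w_0 wt_0] dw dwt _] := sw nu.
have [m0 m0'] := wave_mode0 g nu.
have [_ _ _ _ [indep _]] := hP.
have [x Ox phix] := lin_independent_neq0 nu indep.
apply/eqP; rewrite -subr_eq0; apply/eqP.
apply: (@oscillator_eq0 _ (Tf omega Np) (lam nu)
  (fun t => w t nu - wave_mode g t nu)
  (fun t => wt t nu - wave_mode' g t nu)) => //.
- exact: Tf_gt0.
- move=> r; apply: cvgB; first exact: cw.
  exact: (continuous_subspaceT (@continuous_wave_mode g nu)).
- move=> r; apply: cvgB; first exact: cwt.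
  exact: (continuous_subspaceT (@continuous_wave_mode' g nu)).
- by rewrite w_0 m0 subrr.
- by rewrite wt_0 m0' subrr.
- by move=> r rT; apply: is_deriveB; [exact: dw|exact: is_derive_wave_mode].
- move=> r rT; have := dwt r x rT Ox; rewrite Lop_term// /term => d1.
  have d2 := is_derive_wave_mode' g r nu.
  have d3 : is_derive r 1 (fun t => wt t nu)
      (- lam nu ^+ 2 * w r nu - \sum_m f m nu * cos (omega m * r)).
    (* The equation is known for the coefficient times the eigenfunction; dividing by its nonzero
       value at [x] gives the derivative of the coefficient. *)
    have -> : (fun t => wt t nu)
        = (eigenfun P nu x)^-1 \*: (fun t => wt t nu * eigenfun P nu x).
      by apply/funext => q; rewrite /= /GRing.scale/= mulrC mulfK.
    apply: is_derive_eq; rewrite /GRing.scale/=.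
    apply: (mulfI phix); rewrite mulVKf// mulrBr mulr_sumr.
    congr (_ - _); first by ring.
    by apply: eq_bigr => m _; ring.
  by apply: is_derive_eq; ring.
Qed.

Lemma time_filter_wave_mode g m nu :
  time_filter omega Np a c s m (fun t => wave_mode g t nu)
  = \sum_j beta omega Np a c s m (omega j) * u j nu
    + beta omega Np a c s m (lam nu) * (g nu - \sum_j u j nu).
Proof.
(* [Some j] indexes the forced modes and [None] the free one, so that the solution is a single sum
   of cosines. *)
pose k (o : option 'I_n.+1) :=
  if o is Some j then u j nu else g nu - \sum_j u j nu.
pose w (o : option 'I_n.+1) := if o is Some j then omega j else lam nu.
have sumE (F : R -> R) : \sum_(o : option 'I_n.+1) k o * F (w o)
    = \sum_j u j nu * F (omega j) + (g nu - \sum_j u j nu) * F (lam nu).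
  rewrite (bigD1 None)//= addrC; congr (_ + _).
  rewrite (reindex_omap Some id)/=; last by case.
  by apply: eq_bigl => j; rewrite eqxx.
transitivity (\sum_(o : option 'I_n.+1) k o * beta omega Np a c s m (w o)).
  rewrite -time_filter_cos_sum; apply: eq_time_filter => t _.
  by rewrite (sumE (fun l => cos (l * t))).
rewrite (sumE (beta omega Np a c s m)) [X in _ + X]mulrC; congr (_ + _).
by apply: eq_bigr => j _; rewrite mulrC.
Qed.

(** Uniqueness replaces the wave by its closed form on every filter window; moving the terms in
    [u j nu] to the left turns the update into an equation between errors. The converse direction
    serves to construct iterations. *)
Lemma mfwh_stepE v v' :
  mfwh_step P omega Np a c s f v v' <->
  forall nu, B_omega omega Np a c s *m (\col_m (v' m nu - u m nu))
    = C_mat omega Np a c s (lam nu) *m (\col_m (v m nu - u m nu)).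
Proof.
pose g nu := \sum_m v m nu.
have filterE w wt : solves_wave P omega Np f g w wt -> forall m nu,
    time_filter omega Np a c s m (fun t => w t nu)
    = time_filter omega Np a c s m (fun t => wave_mode g t nu).
  move=> sw m nu; apply: eq_time_filter => t.
  rewrite inE/= in_itv/= => /andP[t0 tT].
  apply: solves_wave_unique sw _ _ _.
  by rewrite in_itv/= t0 (le_trans tT)// Tfm_le_Tf.
have matE nu m :
    (\sum_j beta omega Np a c s m (omega j) * v' j nu
       = time_filter omega Np a c s m (fun t => wave_mode g t nu)) <->
    (B_omega omega Np a c s *m (\col_m (v' m nu - u m nu))) m 0
      = (C_mat omega Np a c s (lam nu) *m (\col_m (v m nu - u m nu))) m 0.
  rewrite time_filter_wave_mode !mxE.
  under [X in _ <-> X = _]eq_bigr do rewrite !mxE mulrBr.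
  under [X in _ <-> _ = X]eq_bigr do rewrite !mxE.
  rewrite -mulr_sumr !sumrB; split => [->|/eqP].
    by rewrite addrAC subrr add0r.
  by rewrite subr_eq addrC => /eqP.
split=> [[w [wt [sw vE]]] nu|vE].
  by apply/colP => m; apply/matE; rewrite vE (filterE _ _ sw).
exists (wave_mode g), (wave_mode' g); split; first exact: wave_mode_solves.
by move=> m nu; apply/matE; rewrite vE.
Qed.

(** * The matrix governing the error *)

Hypothesis hB : B_omega omega Np a c s \in unitmx.

Local Notation M := (M_mat omega Np a c s).

Lemma mfwh_errorS v : mfwh_iteration P omega Np a c s f v -> forall nu k,
  error u v k.+1 nu = M (lam nu) *m error u v k nu.
Proof.
move=> it nu k; rewrite /M_mat -mulmxA.
by have /mfwh_stepE/(_ nu) <- := it k; rewrite mulKmx.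
Qed.

(** Iterates with the predicted errors satisfy [mfwh_stepE] because [B_omega] times [M] is [C_mat].
    Any initial error is thus realised, so statements about all iterations are not vacuous. *)
Lemma mfwh_iteration_exists (e : nat -> 'cV[R]_n.+1) :
  exists2 v, mfwh_iteration P omega Np a c s f v &
    forall k nu, error u v k nu = M (lam nu) ^+ k *m e nu.
Proof.
pose v k m nu := u m nu + (M (lam nu) ^+ k *m e nu) m 0.
have errE k nu : error u v k nu = M (lam nu) ^+ k *m e nu.
  by apply/colP => m; rewrite !mxE addrAC subrr add0r mxE.
exists v => // k; apply/mfwh_stepE => nu.
rewrite -[X in _ *m X = _]/(error u v k.+1 nu).
rewrite -[X in _ = _ *m X]/(error u v k nu).
by rewrite !errE exprS -mulmxE -!mulmxA mulKVmx.
Qed.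

Lemma governs_errorP nu A :
  governs_error P omega Np a c s f u nu A <-> A = M (lam nu).
Proof.
split=> [gA|-> v it k]; last exact: mfwh_errorS.
apply/matrixP => i j.
(* Starting from the [j]-th unit vector, the error after one step is column [j] of the governing
   matrix. *)
have [v it errE] := mfwh_iteration_exists (fun=> delta_mx j 0).
have /colP/(_ i) := gA v it 0%N.
by rewrite !errE expr1 expr0 mul1mx -!colE !mxE.
Qed.

(** * The nonzero eigenvalue, convergence and rate *)

Definition M_col (l : R) : 'cV[R]_n.+1 :=
  invmx (B_omega omega Np a c s) *m \col_i beta omega Np a c s i l.

Lemma M_matE l : M l = M_col l *m (const_mx 1 : 'rV_n.+1).
Proof.
rewrite /M_mat /M_col -mulmxA; congr (_ *m _).
by apply/matrixP => i j; rewrite !mxE big_ord1 !mxE mulr1.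
Qed.

(** All columns of [M l] equal [M_col l], so this is also the trace of [M l]. *)
Definition M_eigenvalue (l : R) : R := \sum_i M_col l i 0.

Lemma const_mx1_M_col l :
  ((const_mx 1 : 'rV_n.+1) *m M_col l) 0 0 = M_eigenvalue l.
Proof. by rewrite mxE; apply: eq_bigr => i _; rewrite mxE mul1r. Qed.

Lemma char_poly_M_mat l : char_poly (M l) = 'X^n * ('X - (M_eigenvalue l)%:P).
Proof. by rewrite M_matE char_poly_rank1 const_mx1_M_col. Qed.

(** From the first step on, errors form a geometric sequence of ratio [M_eigenvalue], which gives
    sufficiency. For necessity, the initial error is the eigenvector [M_col], whose norm cannot
    decrease when the ratio has modulus at least 1. *)
Lemma mfwh_convergesP : mfwh_converges P omega Np a c s f u <->
  forall nu, `|M_eigenvalue (lam nu)| < 1.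
Proof.
have MX nu k : M (lam nu) ^+ k.+1 = M_eigenvalue (lam nu) ^+ k *: M (lam nu).
  by rewrite M_matE expmx_rank1 const_mx1_M_col.
split=> [conv nu|mu1 v it nu]; last first.
  pose e k := error u v k nu.
  have eE k : e k.+1 = M_eigenvalue (lam nu) ^+ k *: e 1%N.
    have -> : e k.+1 = M (lam nu) ^+ k.+1 *m e 0%N.
      elim: k => [|k IH]; first by rewrite expr1; exact: mfwh_errorS.
      by rewrite exprS -mulmxE -mulmxA -IH; exact: mfwh_errorS.
    by rewrite MX -scalemxAl; congr (_ *: _); rewrite /e mfwh_errorS.
  rewrite -[X in X @ _ --> _]/e -cvg_shiftS; under eq_fun do rewrite eE.
  rewrite -(scale0r (e 1%N)); apply: cvgZ; last exact: cvg_cst.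
  exact: cvg_expr.
rewrite ltNge; apply/negP => mu1.
pose x := M_col (lam nu).
(* If [x] vanished, so would the eigenvalue, against [mu1]. *)
have x0 : 0 < `|x|.
  rewrite normr_gt0; apply/eqP => x0; move: mu1.
  rewrite /M_eigenvalue -/x x0 big1 => [|i _]; last by rewrite mxE.
  by rewrite normr0 ler10.
have [v it errE] := mfwh_iteration_exists (fun=> x).
have {}errE k : error u v k nu = M_eigenvalue (lam nu) ^+ k *: x.
  rewrite errE; case: k => [|k]; first by rewrite !expr0 mul1mx scale1r.
  rewrite MX -scalemxAl exprSr -scalerA; congr (_ *: _).
  by rewrite M_matE -mulmxA [_ *m x]mx11_scalar const_mx1_M_col mul_mx_scalar.
have /cvgr0_norm_lt/(_ _ x0)[N _ /(_ N (leqnn N))/=] := conv v it nu.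
by rewrite errE normrZ normrX gtr_pMl// ltNge exprn_ege1.
Qed.

(** By [governs_errorP] each mode has exactly one governing matrix, so both suprema are over the
    same set. *)
Lemma asymptotic_rateE : asymptotic_rate P omega Np a c s f u
  = ereal_sup [set (`|M_eigenvalue (lam nu)|)%:E | nu in [set: nat]].
Proof.
congr ereal_sup.
apply/seteqP; split => [r [nu [A [/governs_errorP-> ->]]]|r [nu _ <-]].
  by exists nu => //; rewrite (spectral_radius_rank1 (char_poly_M_mat _)).
exists nu, (M (lam nu)); split; first exact/governs_errorP.
by rewrite (spectral_radius_rank1 (char_poly_M_mat _)).
Qed.

End wave.

Theorem theorem4p1 (R : realType) (d n : nat) (P : spatial_problem R d)
    (hP : is_spatial_problem P)
    (omega : 'I_n.+1 -> R)
    (omega_gt0 : 0 < omega ord0)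
    (omega_incr : forall i j : 'I_n.+1, (i < j)%N -> omega i < omega j)
    (no_resonance : forall m nu, omega m != eigenval P nu)
    (Np : nat) (Np_gt0 : (0 < Np)%N)
    (a c s : 'I_n.+1 -> R)
    (f u : 'I_n.+1 -> expansion)
    (hu : forall m, solves_helmholtz P (omega m) (f m) (u m))
    (hB : B_omega omega Np a c s \in unitmx) :
  (forall v, mfwh_iteration P omega Np a c s f v ->
     forall nu k : nat,
       error u v k.+1 nu
       = M_mat omega Np a c s (eigenval P nu) *m error u v k nu) /\
  exists mu : R -> R,
    [/\ forall nu, char_poly (M_mat omega Np a c s (eigenval P nu))
                   = 'X^n * ('X - (mu (eigenval P nu))%:P),
        mfwh_converges P omega Np a c s f u <->
          (forall nu, `|mu (eigenval P nu)| < 1)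
      & asymptotic_rate P omega Np a c s f u
        = ereal_sup [set (`|mu (eigenval P nu)|)%:E | nu in [set: nat]]].
Proof.
have omegaP m : 0 < omega m.
  have [->//|m0] := eqVneq m ord0.
  by rewrite (lt_trans omega_gt0)// omega_incr// lt0n.
split; first by move=> v it nu k; exact: (mfwh_errorS hP omegaP Np_gt0 hu hB).
exists (M_eigenvalue omega Np a c s); split.
- by move=> nu; exact: char_poly_M_mat.
- exact: mfwh_convergesP.
- exact: asymptotic_rateE.
Qed.
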